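(* Let $a,b\ge0$ be given integers. Then there are polynomials $A(m,n,d)$ and $B(m,n,d)$ in $m$ and $n$ of total degree at most $2a+b$, with coefficients rational functions of $d$, such that $G^+_{d,m,a,b}(n)=A(m,n,d)M_d(n)+B(m,n,d)M_d(n+1)$.
   Context: For integers $d\ge1$, $n\ge0$ let $\mathcal{A}_{d,n}=\{(i,j):1\le i\le d,\ 1\le j\le n\}$. A subset $I\subseteq\mathcal{A}_{d,n}$ is nice if (1) $(i+1,j)\in I$ with $i\ge1$ implies $(i,j)\in I$, and (2) $(1,j)\in I$ with $1\le j\le n-1$ implies $(1,j+1)\notin I$. $\mathcal{B}^+_{d,n}$ is the set of nice subsets of $\mathcal{A}_{d,n}$. For $I$ nice, $|I|$ is its cardinality and $\sigma_m(I)=\sum_{(i,j)\in I}((i-1)m+j)$ for an integer $m\ge0$. Define $G^+_{d,m,a,b}(n)=\sum_{I\in\mathcal{B}^+_{d,n}}\sigma_m(I)^a|I|^b$ (with $0^0=1$). $M_d(n)$ is defined by $M_d(-1)=0$, $M_d(0)=1$, $M_d(n)=M_d(n-1)+dM_d(n-2)$ for $n\ge1$. *)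

(* Defs.v *)
From HB Require Import structures.
From mathcomp Require Import all_boot all_order all_algebra.
From mathcomp Require Import mpoly.

Set Implicit Arguments.
Unset Strict Implicit.
Unset Printing Implicit Defensive.

Import GRing.Theory.

(* The array A_{d,n} is the type 'I_d * 'I_n with both coordinates shifted
   down by one: p stands for the pair (i, j) = (p.1.+1, p.2.+1). *)
Definition array (d n : nat) : finType := ('I_d * 'I_n)%type.

Definition nice d n (I : {set array d n}) : bool :=
  [forall i : 'I_d, forall i' : 'I_d, forall j : 'I_n,
     (i' == i.+1 :> nat) ==> ((i', j) \in I) ==> ((i, j) \in I)]
  && [forall i : 'I_d, forall j : 'I_n, forall j' : 'I_n,
     (i == 0 :> nat) ==> (j' == j.+1 :> nat) ==>
     ((i, j) \in I) ==> ((i, j') \notin I)].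

(* (i - 1) m + j in the 1-based coordinates *)
Definition sigma m d n (I : {set array d n}) : nat :=
  \sum_(p in I) (p.1 * m + p.2.+1).

(* 0 ^ 0 = 1 for the power of nat *)
Definition Gplus (d m a b n : nat) : nat :=
  \sum_(I : {set array d n} | nice I) sigma m I ^ a * #|I| ^ b.

(* The recurrence starts at index -1: Mshift d k is M_d(k - 1). *)
Fixpoint Mshift (d k : nat) : nat :=
  match k with
  | 0 => 0
  | 1 => 1
  | (k''.+1 as k').+1 => Mshift d k' + d * Mshift d k''
  end.

Definition M (d n : nat) : nat := Mshift d n.+1.

Local Open Scope ring_scope.

Notation ratfun := {fraction {poly rat}}.

(* Numerator and denominator in lowest terms (up to a common nonzero
   constant), so that the denominator vanishes exactly at the poles. *)
Definition ratfun_gcd (f : ratfun) : {poly rat} :=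
  gcdp (\n_(repr f)) (\d_(repr f)).
Definition ratfun_num (f : ratfun) : {poly rat} :=
  \n_(repr f) %/ ratfun_gcd f.
Definition ratfun_den (f : ratfun) : {poly rat} :=
  \d_(repr f) %/ ratfun_gcd f.

Definition ratfun_regular (f : ratfun) (x : rat) : bool :=
  (ratfun_den f).[x] != 0.

(* The value of f at x, meaningful when f is regular at x. *)
Definition ratfun_eval (x : rat) (f : ratfun) : rat :=
  (ratfun_num f).[x] / (ratfun_den f).[x].

(* Polynomials P(m, n, d) in m (variable 0) and n (variable 1) whose
   coefficients are rational functions of d. *)
Definition regular_at (P : {mpoly ratfun[2]}) (d : nat) : Prop :=
  forall u : 'X_{1..2}, ratfun_regular P@_u d%:R.

Definition eval_at (P : {mpoly ratfun[2]}) (m n d : nat) : rat :=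
  mmap (ratfun_eval d%:R) (fun i : 'I_2 => if i == 0 then m%:R else n%:R) P.

(* Main.v *)
Require Import Defs.
From mathcomp Require Import all_boot all_order all_algebra.
From mathcomp Require Import mpoly ssrcomplements.
From mathcomp Require Import ring zify.

(** A nice set is determined by its column heights in [0, d], no two adjacent
heights being nonzero. Removing an empty last column, or a last column of
height h > 0 together with the empty column before it, yields
  G_{a,b}(n+2) = G_{a,b}(n+1)
     + \sum_{h=1..d} \sum_I (sigma I + m C(h,2) + (n+2) h)^a (|I| + h)^b
with I nice in A_{d,n}. Expanding, G_{a,b} solves X(n+2) - X(n+1) - d X(n) = g(n),
where g combines the moments G_{a-i,b-j}, (i,j) <> (0,0), with coefficients of
degree i in m and n, so that by induction g = P M_d(n) + Q M_d(n+1) with P and Q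
of degree at most 2a+b-1. As M_d(n) and M_d(n+1) solve the homogeneous equation
and the characteristic roots are distinct, solving raises the degree by exactly
one; the only denominators are powers of d and of 1 + 4d. *)

Set Implicit Arguments.
Unset Strict Implicit.
Unset Printing Implicit Defensive.

Import Order.TTheory GRing.Theory Num.Theory.
Local Open Scope ring_scope.

(** * Evaluating rational functions through arbitrary fractions *)

Local Notation tofrac := (@FracField.tofrac {poly rat}).

Lemma ratfunM_den (f : ratfun) : f * tofrac \d_(repr f) = tofrac \n_(repr f).
Proof.
move: (repr f) (reprK f) => r <-.
unlock FracField.tofrac; rewrite -[LHS]FracField.pi_mul.
apply/eqmodP; rewrite /= FracField.equivfE /FracField.mulf.
by rewrite !numden_Ratio ?mulf_neq0 ?oner_eq0 ?denom_ratioP //= !mulr1 mulrC.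
Qed.

(** The numerator and denominator in lowest terms are coprime, so by Gauss's lemma the reduced
    denominator divides [q] and cannot vanish at [x] either. Any convenient fraction may thus
    replace the reduced one. *)
Lemma ratfun_eval_frac (f : ratfun) (p q : {poly rat}) (x : rat) :
  f * tofrac q = tofrac p -> q.[x] != 0 ->
  ratfun_regular f x /\ ratfun_eval x f = p.[x] / q.[x].
Proof.
move=> fqp qx.
have dn0 : \d_(repr f) != 0 by apply: denom_ratioP.
have e : \n_(repr f) * q = p * \d_(repr f).
  apply/eqP; rewrite -(tofrac_eq (_ * _)) !rmorphM /= -ratfunM_den -fqp.
  by rewrite mulrAC.
have g0 : ratfun_gcd f != 0 by rewrite gcdp_eq0 negb_and dn0 orbT.
have cop : coprimep (ratfun_num f) (ratfun_den f).
  by apply: coprimep_div_gcd; rewrite dn0 orbT.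
have en : \n_(repr f) = ratfun_num f * ratfun_gcd f by rewrite divpK // dvdp_gcdl.
have ed : \d_(repr f) = ratfun_den f * ratfun_gcd f by rewrite divpK // dvdp_gcdr.
have {}e : ratfun_num f * q = p * ratfun_den f.
  by apply: (mulIf g0); rewrite mulrAC -en -mulrA -ed.
have dq : ratfun_den f %| q.
  rewrite -(Gauss_dvdpr q (_ : coprimep _ (ratfun_num f))) 1?coprimep_sym //.
  by rewrite e dvdp_mull.
have dx : (ratfun_den f).[x] != 0.
  apply: contraNneq qx => dx0; case/dvdpP: dq => r ->.
  by rewrite hornerM dx0 mulr0.
split => //; rewrite /ratfun_eval.
move/(congr1 (horner^~ x)): e; rewrite !hornerM => e.
by apply/eqP; rewrite eqr_div // e.
Qed.

Lemma ratfun_regular_frac (f : ratfun) (x : rat) : ratfun_regular f x ->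
  exists p q : {poly rat}, [/\ f * tofrac q = tofrac p, q.[x] != 0 &
    ratfun_eval x f = p.[x] / q.[x]].
Proof.
move=> fx; exists (ratfun_num f), (ratfun_den f); split => //.
have dn0 : \d_(repr f) != 0 by apply: denom_ratioP.
have g0 : ratfun_gcd f != 0 by rewrite gcdp_eq0 negb_and dn0 orbT.
have en : \n_(repr f) = ratfun_num f * ratfun_gcd f by rewrite divpK // dvdp_gcdl.
have ed : \d_(repr f) = ratfun_den f * ratfun_gcd f by rewrite divpK // dvdp_gcdr.
have := ratfunM_den f; rewrite en ed !rmorphM /= mulrA; apply: mulIf.
by rewrite tofrac_eq0.
Qed.

(** A sum of reduced fractions may admit further cancellation, so it is evaluated through the
    unreduced fraction over [q * q']. *)
Lemma ratfun_evalD (f g : ratfun) (x : rat) :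
  ratfun_regular f x -> ratfun_regular g x ->
  ratfun_regular (f + g) x /\
  ratfun_eval x (f + g) = ratfun_eval x f + ratfun_eval x g.
Proof.
move=> /ratfun_regular_frac [p [q [e qx ->]]] /ratfun_regular_frac [p' [q' [e' qx' ->]]].
have -> : p.[x] / q.[x] + p'.[x] / q'.[x] = (p * q' + p' * q).[x] / (q * q').[x].
  by rewrite !hornerE; field; rewrite qx qx'.
apply: ratfun_eval_frac; last by rewrite hornerM mulf_neq0.
by rewrite rmorphD !rmorphM /= -e -e'; ring.
Qed.

Lemma ratfun_evalC (c x : rat) :
  ratfun_regular (tofrac c%:P) x /\ ratfun_eval x (tofrac c%:P) = c.
Proof.
rewrite -[X in _ /\ _ = X]divr1 -[in X in _ /\ _ = X](hornerC c x).
rewrite -[in X in _ /\ _ = _ / X](hornerC 1 x).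
by apply: ratfun_eval_frac; rewrite ?hornerC ?oner_eq0 // rmorph1 mulr1.
Qed.

(** * Functions of [d] that are rational without poles at positive integers *)

(** One pair [p], [q] serves all [d]. The value [d = 0] is left out because solving the recurrence
    divides by [d]. *)
Definition rational_on_pos (c : nat -> rat) : Prop :=
  exists p q : {poly rat}, forall d, (0 < d)%N ->
    q.[d%:R] != 0 /\ c d = p.[d%:R] / q.[d%:R].

Lemma rational_on_pos_eq c c' : (forall d, (0 < d)%N -> c d = c' d) ->
  rational_on_pos c -> rational_on_pos c'.
Proof.
move=> e [p [q H]]; exists p, q => d d0.
by rewrite -e //; apply: H.
Qed.

Lemma rational_on_pos_poly (p : {poly rat}) : rational_on_pos (fun d => p.[d%:R]).
Proof. by exists p, 1 => d _; rewrite hornerC divr1 oner_eq0. Qed.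

Lemma rational_on_posC (x : rat) : rational_on_pos (fun=> x).
Proof.
by apply: rational_on_pos_eq (rational_on_pos_poly x%:P) => d _; rewrite hornerC.
Qed.

Lemma rational_on_pos_id : rational_on_pos (fun d => d%:R).
Proof.
by apply: rational_on_pos_eq (rational_on_pos_poly 'X) => d _; rewrite hornerX.
Qed.

Lemma rational_on_posD c c' : rational_on_pos c -> rational_on_pos c' ->
  rational_on_pos (fun d => c d + c' d).
Proof.
move=> [p [q H]] [p' [q' H']]; exists (p * q' + p' * q), (q * q') => d d0.
have [qd ->] := H d d0; have [qd' ->] := H' d d0.
by rewrite !(hornerD, hornerM) mulf_neq0 //; split => //; field; rewrite qd qd'.
Qed.

Lemma rational_on_posM c c' : rational_on_pos c -> rational_on_pos c' ->
  rational_on_pos (fun d => c d * c' d).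
Proof.
move=> [p [q H]] [p' [q' H']]; exists (p * p'), (q * q') => d d0.
have [qd ->] := H d d0; have [qd' ->] := H' d d0.
by rewrite !(hornerD, hornerM) mulf_neq0 //; split => //; field; rewrite qd qd'.
Qed.

Lemma rational_on_posV c : rational_on_pos c ->
  (forall d, (0 < d)%N -> c d != 0) -> rational_on_pos (fun d => (c d)^-1).
Proof.
move=> [p [q H]] cn0; exists q, p => d d0.
have [qd e] := H d d0; have := cn0 d d0; rewrite e mulf_eq0 negb_or => /andP [pd _].
by split => //; field; rewrite qd pd.
Qed.

Lemma rational_on_pos_ratfun c : rational_on_pos c ->
  exists f : ratfun, forall d, (0 < d)%N ->
    ratfun_regular f d%:R /\ ratfun_eval d%:R f = c d.
Proof.
move=> [p [q H]]; exists (tofrac p / tofrac q) => d d0.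
have [qd ->] := H d d0; apply: ratfun_eval_frac => //.
rewrite mulfVK // tofrac_eq0; by apply: contraNneq qd => ->; rewrite horner0.
Qed.

(** * Polynomials in [m] and [n]: binomial form and [mpoly] form *)

(** Induction on [k] through [(k+1) C(n,k+1) = (n-k) C(n,k)]. *)
Lemma binomial_horner k :
  exists2 p : {poly rat}, (size p <= k.+1)%N & forall n, 'C(n, k)%:R = p.[n%:R].
Proof.
elim: k => [|k [p sp IH]].
  by exists 1; [rewrite size_poly1 | move=> n; rewrite bin0 hornerC].
exists ((k.+1%:R)^-1 *: (p * ('X - k%:R%:P))).
  apply: leq_trans (size_scale_leq _ _) _.
  apply: leq_trans (size_polyMleq _ _) _.
  by rewrite size_XsubC addn2 /=.
move=> n; rewrite hornerZ hornerM hornerXsubC -IH.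
have k0 : k.+1%:R != 0 :> rat by rewrite pnatr_eq0.
apply: (mulfI k0); rewrite mulVKf // -natrM mul_bin_left natrM mulrC.
(* The truncated difference [n - k] differs from the true one only for [n < k], where the binomial
   is zero. *)
have [kn|nk] := leqP k n; first by rewrite natrB.
by rewrite bin_small // !mul0r.
Qed.

(* Binomials C(n, j) rather than powers of n, because shifting n then produces
   a single lower term. *)
Inductive polyspan (k : nat) : (nat -> nat -> nat -> rat) -> Prop :=
| polyspan0 f :
    (forall d m n, (0 < d)%N -> f d m n = 0) -> polyspan k f
| polyspan_cons c i j g f :
    rational_on_pos c -> (i + j <= k)%N -> polyspan k g ->
    (forall d m n, (0 < d)%N -> f d m n = c d * m%:R ^+ i * 'C(n, j)%:R + g d m n) ->
    polyspan k f.

Definition mpoly_repr k (f : nat -> nat -> nat -> rat) : Prop :=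
  exists2 P : {mpoly ratfun[2]}, (msize P <= k.+1)%N &
    forall d, (0 < d)%N -> regular_at P d /\ forall m n, f d m n = eval_at P m n d.

Lemma mpoly_repr_eq k f g : (forall d m n, (0 < d)%N -> f d m n = g d m n) ->
  mpoly_repr k f -> mpoly_repr k g.
Proof.
move=> e [P sP H]; exists P => // d d0; have [rP eP] := H d d0.
by split => // m n; rewrite -e.
Qed.

Lemma ratfun_eval0 x : ratfun_regular 0 x /\ ratfun_eval x 0 = 0.
Proof. by have := ratfun_evalC 0 x; rewrite !rmorph0. Qed.

(** Additivity of [ratfun_eval] rests on regularity, so sums of polynomials are evaluated
    coefficient by coefficient over one common set of monomials. The padding is harmless because
    [ratfun_eval] sends 0 to 0. *)
Lemma eval_at_widen k (P : {mpoly ratfun[2]}) m n d : (msize P <= k)%N ->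
  eval_at P m n d = \sum_(u : 'X_{1..2 < k}) ratfun_eval d%:R P@_u *
     mmap1 (fun i : 'I_2 => if i == 0 then m%:R else n%:R) u.
Proof.
move=> le_pk; set I : subFinType _ := 'X_{1..2 < k}.
rewrite /eval_at /mmap (big_mksub I) ?msupp_uniq //=; first last.
  by move=> x /msize_mdeg_lt /leq_trans; apply.
rewrite big_rmcond //= => j /memN_msupp_eq0 ->.
by rewrite (ratfun_eval0 _).2 mul0r.
Qed.

Lemma mpoly_repr0 k : mpoly_repr k (fun _ _ _ => 0).
Proof.
exists 0; first by rewrite mmeasure0.
move=> d _; split=> [u|m n]; first by rewrite mcoeff0; exact: (ratfun_eval0 _).1.
by rewrite /eval_at /mmap msupp0 big_nil.
Qed.

Lemma mpoly_reprD k f g : mpoly_repr k f -> mpoly_repr k g ->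
  mpoly_repr k (fun d m n => f d m n + g d m n).
Proof.
move=> [P sP HP] [Q sQ HQ]; have sPQ : (msize (P + Q) <= k.+1)%N.
  by apply: leq_trans (msizeD_le _ _) _; rewrite geq_max sP.
exists (P + Q) => // d d0; have [rP eP] := HP d d0; have [rQ eQ] := HQ d d0.
split=> [u|m n]; first by rewrite mcoeffD; exact: (ratfun_evalD (rP u) (rQ u)).1.
rewrite eP eQ !(eval_at_widen _ _ _ (k := k.+1)) // -big_split /=.
apply: eq_bigr => u _.
by rewrite mcoeffD (ratfun_evalD (rP u) (rQ u)).2 mulrDl.
Qed.

Lemma mpoly_repr_monomial k c i j : rational_on_pos c -> (i + j <= k)%N ->
  mpoly_repr k (fun d m n => c d * m%:R ^+ i * n%:R ^+ j).
Proof.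
move=> /rational_on_pos_ratfun [f Hf] ijk.
pose u : 'X_{1..2} := [multinom (if t == 0%R then i else j) | t < 2].
have degu : mdeg u = (i + j)%N by rewrite mdegE big_ord_recl big_ord1 !mnmE.
have sX : (msize (f *: 'X_[ratfun, u]) <= k.+1)%N.
  apply: leq_trans (mmeasureZ_le _ _ _) _.
  by rewrite msizeX degu.
exists (f *: 'X_[u]) => // d d0; have [rf ef] := Hf d d0.
split=> [v|m n].
  rewrite mcoeffZ mcoeffX; case: eqP => _; rewrite ?mulr1 ?mulr0 //.
  exact: (ratfun_eval0 _).1.
have uk : (mdeg u < k.+1)%N by rewrite degu.
rewrite (eval_at_widen _ _ _ sX) (bigD1 (BMultinom uk)) //= big1 ?addr0.
  rewrite mcoeffZ mcoeffX eqxx mulr1 ef /mmap1 big_ord_recl big_ord1 !mnmE /=.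
  by rewrite mulrA.
move=> v /negbTE; rewrite mcoeffZ mcoeffX -val_eqE /= eq_sym => ->.
by rewrite mulr0 (ratfun_eval0 _).2 mul0r.
Qed.

Lemma mpoly_repr_sum (I : Type) (r : seq I) k F :
  (forall i, mpoly_repr k (F i)) ->
  mpoly_repr k (fun d m n => \sum_(i <- r) F i d m n).
Proof.
move=> HF; elim: r => [|i r IH].
  by apply: mpoly_repr_eq (mpoly_repr0 k) => d m n _; rewrite big_nil.
apply: mpoly_repr_eq (mpoly_reprD (HF i) IH) => d m n _.
by rewrite big_cons.
Qed.

(** Expanding [C(n,j)] in powers of [n] produces degrees at most [j] only, so the total degree bound
    survives. *)
Lemma polyspan_mpoly k f : polyspan k f -> mpoly_repr k f.
Proof.
elim=> {f} [f f0|c i j g f rc ijk _ IH e].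
  by apply: mpoly_repr_eq (mpoly_repr0 k) => d m n d0; rewrite f0.
have [p sp Hp] := binomial_horner j.
have H : mpoly_repr k (fun d m n =>
    \sum_(l < j.+1) c d * p`_l * m%:R ^+ i * n%:R ^+ l).
  apply: mpoly_repr_sum => l; apply: mpoly_repr_monomial.
    by apply: rational_on_posM => //; apply: rational_on_posC.
  by apply: leq_trans ijk; rewrite leq_add2l -ltnS.
apply: mpoly_repr_eq (mpoly_reprD H IH) => d m n d0.
rewrite e // Hp (horner_coef_wide _ sp) mulr_sumr; congr (_ + _).
by apply: eq_bigr => l _; ring.
Qed.

(** * Sums of polynomials over the heights 1 to [d] *)

Lemma rational_on_pos_sum (I : Type) (r : seq I) F :
  (forall i, rational_on_pos (F i)) ->
  rational_on_pos (fun d => \sum_(i <- r) F i d).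
Proof.
move=> HF; elim: r => [|i r IH].
  by apply: rational_on_pos_eq (rational_on_posC 0) => d _; rewrite big_nil.
by apply: rational_on_pos_eq (rational_on_posD (HF i) IH) => d _; rewrite big_cons.
Qed.

(** Faulhaber's sums by strong induction: telescoping [(h+2)^(k+1) - (h+1)^(k+1)] over [h < d] and
    expanding expresses [(d+1)^(k+1) - 1] by the power sums of exponents 0 to [k]. The last one has
    coefficient [k+1] and can be isolated. *)
Lemma rational_on_pos_powersum k :
  rational_on_pos (fun d => \sum_(h < d) h.+1%:R ^+ k).
Proof.
elim/ltn_ind: k => k IH.
have H : rational_on_pos (fun d => k.+1%:R^-1 * (('X + 1) ^+ k.+1 - 1 : {poly rat}).[d%:R]
   + \sum_(j < k) - (k.+1%:R^-1 * 'C(k.+1, j)%:R) * \sum_(h < d) h.+1%:R ^+ j).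
  apply: rational_on_posD.
    by apply: rational_on_posM; [exact: rational_on_posC|exact: rational_on_pos_poly].
  apply: rational_on_pos_sum => j.
  by apply: rational_on_posM; [exact: rational_on_posC|exact: IH].
apply: rational_on_pos_eq H => d _.
have k0 : k.+1%:R != 0 :> rat by rewrite pnatr_eq0.
have tele : (d%:R + 1) ^+ k.+1 - 1 =
    \sum_(j < k.+1) 'C(k.+1, j)%:R * \sum_(h < d) h.+1%:R ^+ j :> rat.
  rewrite -[in X in _ - X](expr1n rat k.+1) -[in X in _ - X](add0r (1 : rat)).
  rewrite -(telescope_sumr (fun h => (h%:R + 1) ^+ k.+1 : rat) (leq0n d)).
  under [RHS]eq_bigr do rewrite mulr_sumr.
  rewrite exchange_big /= big_mkord; apply: eq_bigr => h _.
  rewrite (natr1 h) [_ + 1]addrC exprDn big_ord_recr /= subnn expr0 mul1r binn addrK.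
  by apply: eq_bigr => j _; rewrite expr1n mul1r mulr_natl.
rewrite !(hornerD, hornerN, horner_exp, hornerX, hornerC) tele big_ord_recr /=.
rewrite binSn mulrDr mulKf // addrAC mulr_sumr -big_split /= big1 ?add0r // => j _.
by rewrite mulrA mulNr subrr.
Qed.

Lemma rational_on_pos_polysum (p : {poly rat}) :
  rational_on_pos (fun d => \sum_(h < d) p.[h.+1%:R]).
Proof.
have H : rational_on_pos (fun d => \sum_(k < size p) p`_k * \sum_(h < d) h.+1%:R ^+ k).
  apply: rational_on_pos_sum => k.
  by apply: rational_on_posM; [exact: rational_on_posC|exact: rational_on_pos_powersum].
apply: rational_on_pos_eq H => d _.
under eq_bigr do rewrite mulr_sumr.
by rewrite exchange_big /=; apply: eq_bigr => h _; rewrite horner_coef.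
Qed.

(** * Closure properties of polynomials in binomial form *)

Lemma polyspan_eq k f g : (forall d m n, (0 < d)%N -> f d m n = g d m n) ->
  polyspan k f -> polyspan k g.
Proof.
move=> e Hf; case: Hf e => [{}f f0|c i j f' {}f rc ijk Hf' e'] e.
  by apply: polyspan0 => d m n d0; rewrite -e // f0.
by apply: (polyspan_cons rc ijk Hf') => d m n d0; rewrite -e // e'.
Qed.

Lemma polyspan_monomial k c i j : rational_on_pos c -> (i + j <= k)%N ->
  polyspan k (fun d m n => c d * m%:R ^+ i * 'C(n, j)%:R).
Proof.
move=> rc ijk; apply: (polyspan_cons rc ijk (g := fun _ _ _ => 0)).
  exact: polyspan0.
by move=> d m n _; rewrite addr0.
Qed.

Lemma polyspanD k f g : polyspan k f -> polyspan k g ->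
  polyspan k (fun d m n => f d m n + g d m n).
Proof.
move=> Hf Hg; elim: Hf => {f} [f f0|c i j f' f rc ijk _ IH e].
  by apply: polyspan_eq Hg => d m n d0; rewrite f0 // add0r.
by apply: (polyspan_cons rc ijk IH) => d m n d0; rewrite e // addrA.
Qed.

Lemma polyspanZ k c f : rational_on_pos c -> polyspan k f ->
  polyspan k (fun d m n => c d * f d m n).
Proof.
move=> Hc; elim=> {f} [f f0|c' i j f' f rc ijk _ IH e].
  by apply: polyspan0 => d m n d0; rewrite f0 // mulr0.
apply: (polyspan_cons (rational_on_posM Hc rc) ijk IH) => d m n d0.
by rewrite e //; ring.
Qed.

Lemma polyspan_leq k l f : (k <= l)%N -> polyspan k f -> polyspan l f.
Proof.
move=> kl; elim=> {f} [f f0|c i j f' f rc ijk _ IH e]; first exact: polyspan0.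
exact: (polyspan_cons rc (leq_trans ijk kl) IH e).
Qed.

Lemma polyspan_mulm k f : polyspan k f ->
  polyspan k.+1 (fun d m n => m%:R * f d m n).
Proof.
elim=> {f} [f f0|c i j f' f rc ijk _ IH e].
  by apply: polyspan0 => d m n d0; rewrite f0 // mulr0.
apply: (polyspan_cons (i := i.+1) (j := j) rc _ IH) => // d m n d0.
by rewrite e // exprS; ring.
Qed.

(** In the binomial basis, multiplication by [n] gives one term of the next index and one of the
    same index, so the degree rises by one. *)
Lemma polyspan_muln k f : polyspan k f ->
  polyspan k.+1 (fun d m n => n%:R * f d m n).
Proof.
elim=> {f} [f f0|c i j f' f rc ijk _ IH e].
  by apply: polyspan0 => d m n d0; rewrite f0 // mulr0.
have rcn (x : rat) := rational_on_posM rc (rational_on_posC x).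
have ij1 : (i + j.+1 <= k.+1)%N by rewrite addnS.
have H := polyspanD (polyspan_monomial (rcn j.+1%:R) ij1)
  (polyspan_monomial (rcn j%:R) (leqW ijk)).
apply: polyspan_eq (polyspanD H IH) => d m n d0; rewrite e //.
have nC : n%:R * 'C(n, j)%:R = j.+1%:R * 'C(n, j.+1)%:R + j%:R * 'C(n, j)%:R :> rat.
  rewrite -!natrM mul_bin_left -natrD -mulnDl; case: (leqP j n) => jn.
    by rewrite subnK.
  by rewrite bin_small // !muln0.
by rewrite mulrDr [n%:R * (_ * _)]mulrCA nC; ring.
Qed.

Lemma polyspan_fix_n k f t : polyspan k f -> polyspan k (fun d m _ => f d m t).
Proof.
elim=> {f} [f f0|c i j f' f rc ijk _ IH e].
  by apply: polyspan0 => d m n d0; rewrite f0.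
have rc' := rational_on_posM rc (rational_on_posC 'C(t, j)%:R).
apply: (polyspan_cons (i := i) (j := 0) rc' _ IH).
  by rewrite addn0; apply: leq_trans ijk; apply: leq_addr.
by move=> d m n d0; rewrite e // bin0; ring.
Qed.

(* [n + e] is the 1-based index of the column of height [h + 1]. *)
Definition colsum (e i : nat) (p : {poly rat}) (d m n : nat) : rat :=
  \sum_(h < d) (m * 'C(h.+1, 2) + (n + e) * h.+1)%:R ^+ i * p.[h.+1%:R].

(** Each of the [i] weight factors splits as [m C(h,2) + n h + e h], at most linear in [m] and [n].
    Its dependence on the height [h] is absorbed into [p], hence the induction with [p] general, and
    the final sum over [h] is rational in [d]. *)
Lemma polyspan_colsum e i p k f : polyspan k f ->
  polyspan (i + k) (fun d m n => colsum e i p d m n * f d m n).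
Proof.
move=> Hf; elim: i p => [|i IH] p.
  apply: polyspan_eq (polyspanZ (rational_on_pos_polysum p) Hf) => d m n _.
  by congr (_ * _); apply: eq_bigr => h _; rewrite mul1r.
have [b _ Hb] := binomial_horner 2.
have H := polyspanD (polyspan_mulm (IH (b * p)))
  (polyspanD (polyspan_muln (IH ('X * p)))
     (polyspan_leq (leqnSn _)
        (polyspanZ (rational_on_posC e%:R) (IH ('X * p))))).
apply: polyspan_eq H => d m n _.
rewrite !mulrA -!mulrDl; congr (_ * _); rewrite /colsum.
rewrite !mulr_sumr -!big_split /=; apply: eq_bigr => h _.
by rewrite !hornerM hornerX -Hb exprS !(natrD, natrM); ring.
Qed.

(** * Combinations of [M_d(n)] and [M_d(n+1)] with polynomial coefficients *)

Definition mspan (k : nat) (f : nat -> nat -> nat -> rat) : Prop :=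
  exists A B, [/\ polyspan k A, polyspan k B & forall d m n, (0 < d)%N ->
    f d m n = A d m n * (M d n)%:R + B d m n * (M d n.+1)%:R].

Lemma mspan_eq k f g : (forall d m n, (0 < d)%N -> f d m n = g d m n) ->
  mspan k f -> mspan k g.
Proof.
by move=> e [A [B [HA HB H]]]; exists A, B; split=> // d m n d0; rewrite -e // H.
Qed.

Lemma mspan0 k : mspan k (fun _ _ _ => 0).
Proof.
exists (fun _ _ _ => 0), (fun _ _ _ => 0); split; try exact: polyspan0.
by move=> d m n _; rewrite !mul0r addr0.
Qed.

Lemma mspanD k f g : mspan k f -> mspan k g ->
  mspan k (fun d m n => f d m n + g d m n).
Proof.
move=> [A [B [HA HB H]]] [A' [B' [HA' HB' H']]].
exists (fun d m n => A d m n + A' d m n), (fun d m n => B d m n + B' d m n).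
split; try exact: polyspanD.
by move=> d m n d0; rewrite H // H' //; ring.
Qed.

Lemma mspanZ k c f : rational_on_pos c -> mspan k f ->
  mspan k (fun d m n => c d * f d m n).
Proof.
move=> rc [A [B [HA HB H]]].
exists (fun d m n => c d * A d m n), (fun d m n => c d * B d m n).
by split; try exact: polyspanZ; move=> d m n d0; rewrite H //; ring.
Qed.

Lemma mspan_leq k l f : (k <= l)%N -> mspan k f -> mspan l f.
Proof.
move=> kl [A [B [HA HB H]]]; exists A, B.
by split=> //; apply: polyspan_leq kl _.
Qed.

Lemma mspan_sum (I : Type) (r : seq I) (P : pred I) k F :
  (forall i, P i -> mspan k (F i)) ->
  mspan k (fun d m n => \sum_(i <- r | P i) F i d m n).
Proof.
move=> HF; elim: r => [|i r IH].
  by apply: mspan_eq (mspan0 k) => d m n _; rewrite big_nil.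
case Pi: (P i).
  apply: mspan_eq (mspanD (HF i Pi) IH) => d m n _.
  by rewrite big_cons Pi.
by apply: mspan_eq IH => d m n _; rewrite big_cons Pi.
Qed.

Lemma mspan_colsum e i p k f : mspan k f ->
  mspan (i + k) (fun d m n => colsum e i p d m n * f d m n).
Proof.
move=> [A [B [HA HB H]]].
exists (fun d m n => colsum e i p d m n * A d m n),
  (fun d m n => colsum e i p d m n * B d m n).
by split; try exact: polyspan_colsum; move=> d m n d0; rewrite H //; ring.
Qed.

(** * Solving the inhomogeneous recurrence *)

Lemma M_rec d n : (M d n.+2)%:R = (M d n.+1)%:R + d%:R * (M d n)%:R :> rat.
Proof. by rewrite -natrM -natrD. Qed.

(** The operator of the recurrence of [M]; it annihilates both [M_d(n)] and [M_d(n+1)]. *)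
Definition defect (f : nat -> nat -> nat -> rat) (d m n : nat) : rat :=
  f d m n.+2 - f d m n.+1 - d%:R * f d m n.

Definition solvable (k : nat) (g : nat -> nat -> nat -> rat) : Prop :=
  exists2 X, mspan k.+1 X & forall d m n, (0 < d)%N -> defect X d m n = g d m n.

Lemma solvable_eq k f g : (forall d m n, (0 < d)%N -> f d m n = g d m n) ->
  solvable k f -> solvable k g.
Proof. by move=> e [X HX H]; exists X => // d m n d0; rewrite -e // H. Qed.

Lemma solvable0 k : solvable k (fun _ _ _ => 0).
Proof.
exists (fun _ _ _ => 0); first exact: mspan0.
by move=> d m n _; rewrite /defect; ring.
Qed.

Lemma solvableD k f g : solvable k f -> solvable k g ->
  solvable k (fun d m n => f d m n + g d m n).
Proof.
move=> [X HX H] [Y HY H']; exists (fun d m n => X d m n + Y d m n).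
  exact: mspanD.
by move=> d m n d0; rewrite -H // -H' // /defect; ring.
Qed.

(* The linear system relating the leading coefficients of a particular solution
   to those of the right-hand side; its determinant is d (1 + 4d). *)
Lemma rational_on_pos_solution c1 c2 : rational_on_pos c1 -> rational_on_pos c2 ->
  exists alpha beta, [/\ rational_on_pos alpha, rational_on_pos beta &
    forall d, (0 < d)%N ->
      c1 d = d%:R * (2 * alpha d + beta d) /\
      c2 d = alpha d + (1 + 2 * d%:R) * beta d].
Proof.
move=> rc1 rc2; have rC := rational_on_posC.
have rdV : rational_on_pos (fun d => d%:R^-1).
  by apply: (rational_on_posV rational_on_pos_id) => d; rewrite pnatr_eq0 -lt0n.
have rdisc : rational_on_pos (fun d => (1 + 4 * d)%:R^-1).
  apply: rational_on_posV => [|d _]; last by rewrite pnatr_eq0.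
  apply: rational_on_pos_eq
    (rational_on_posD (rC 1) (rational_on_posM (rC 4) rational_on_pos_id)) => d _.
  by rewrite natrD natrM.
have rc1d := rational_on_posM rc1 rdV.
(* Cramer's rule after dividing the first equation by [d], which leaves the determinant [1 + 4d]. *)
exists (fun d => ((c1 d * d%:R^-1 + 2 * c1 d) + -1 * c2 d) * (1 + 4 * d)%:R^-1),
  (fun d => (2 * c2 d + -1 * (c1 d * d%:R^-1)) * (1 + 4 * d)%:R^-1); split.
- apply: rational_on_posM => //; apply: rational_on_posD.
    by apply: rational_on_posD => //; exact: rational_on_posM.
  exact: rational_on_posM.
- by apply: rational_on_posM => //; apply: rational_on_posD; exact: rational_on_posM.
move=> d d0; have dn0 : d%:R != 0 :> rat by rewrite pnatr_eq0 -lt0n.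
have D0 : (1 + 4 * d)%:R != 0 :> rat by rewrite pnatr_eq0.
move: D0; rewrite natrD natrM => D0.
by split; field; rewrite dn0 D0.
Qed.

(** Put [L(n) = alpha M_d(n) + beta M_d(n+1)] and try [m^i C(n,j+1) L(n)]. The terms in [C(n,j+1)]
    cancel in its defect, leaving [m^i] times [C(n,j) (2 L(n+2) - L(n+1)) + (C(n+1,j) - C(n,j))
    L(n+2)]. The choice of [alpha] and [beta] makes [2 L(n+2) - L(n+1)] the prescribed
    combination. *)
Lemma solvable_leading k i j c1 c2 :
  rational_on_pos c1 -> rational_on_pos c2 -> (i + j <= k)%N ->
  exists e1 e2, [/\ rational_on_pos e1, rational_on_pos e2 &
    solvable k (fun d m n => m%:R ^+ i *
      ('C(n, j)%:R * (c1 d * (M d n)%:R + c2 d * (M d n.+1)%:R) +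
       ('C(n.+1, j)%:R - 'C(n, j)%:R) * (e1 d * (M d n)%:R + e2 d * (M d n.+1)%:R)))].
Proof.
move=> rc1 rc2 ijk.
have [alpha [beta [ra rb Hab]]] := rational_on_pos_solution rc1 rc2.
have rd := rational_on_pos_id; have r1 := rational_on_posC 1.
(* The coordinates of [L(n+2)] with respect to [M_d(n)] and [M_d(n+1)]. *)
exists (fun d => d%:R * (alpha d + beta d)), (fun d => alpha d + (1 + d%:R) * beta d).
split.
- by apply: rational_on_posM => //; exact: rational_on_posD.
- apply: rational_on_posD => //; apply: rational_on_posM => //.
  exact: rational_on_posD.
exists (fun d m n => alpha d * m%:R ^+ i * 'C(n, j.+1)%:R * (M d n)%:R +
                     beta d * m%:R ^+ i * 'C(n, j.+1)%:R * (M d n.+1)%:R).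
  exists (fun d m n => alpha d * m%:R ^+ i * 'C(n, j.+1)%:R),
    (fun d m n => beta d * m%:R ^+ i * 'C(n, j.+1)%:R).
  by split=> //; apply: polyspan_monomial; rewrite // addnS.
move=> d m n d0; have [-> ->] := Hab d d0.
by rewrite /defect !M_rec !binS !natrD; ring.
Qed.

(** The error left by the trial solution carries the factor [C(n+1,j) - C(n,j)], which is zero for
    [j = 0] and [C(n,j-1)] otherwise, so induction on [j] removes it. *)
Lemma solvable_monomial k i j c1 c2 :
  rational_on_pos c1 -> rational_on_pos c2 -> (i + j <= k)%N ->
  solvable k (fun d m n => m%:R ^+ i * 'C(n, j)%:R *
    (c1 d * (M d n)%:R + c2 d * (M d n.+1)%:R)).
Proof.
elim: j c1 c2 => [|j IH] c1 c2 rc1 rc2 ijk;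
  have [e1 [e2 [re1 re2 H]]] := solvable_leading rc1 rc2 ijk.
  by apply: solvable_eq H => d m n _; rewrite !bin0; ring.
have rN c : rational_on_pos c -> rational_on_pos (fun d => -1 * c d).
  by apply: rational_on_posM; exact: rational_on_posC.
have ijk' : (i + j <= k)%N by apply: ltnW; rewrite -addnS.
apply: solvable_eq (solvableD H (IH _ _ (rN _ re1) (rN _ re2) ijk')) => d m n _.
by rewrite binS natrD; ring.
Qed.

Lemma solvable_polyspan k f c1 c2 :
  rational_on_pos c1 -> rational_on_pos c2 -> polyspan k f ->
  solvable k (fun d m n => f d m n * (c1 d * (M d n)%:R + c2 d * (M d n.+1)%:R)).
Proof.
move=> rc1 rc2; elim=> {f} [f f0|c i j f' f rc ijk _ IH e].
  by apply: solvable_eq (solvable0 k) => d m n d0; rewrite f0 // mul0r.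
have H := solvable_monomial (rational_on_posM rc rc1) (rational_on_posM rc rc2) ijk.
by apply: solvable_eq (solvableD H IH) => d m n d0; rewrite e //; ring.
Qed.

Lemma solvable_mspan k g : mspan k g -> solvable k g.
Proof.
move=> [A [B [HA HB H]]].
have r x := rational_on_posC x.
apply: solvable_eq (solvableD (solvable_polyspan (r 1) (r 0) HA)
  (solvable_polyspan (r 0) (r 1) HB)) => d m n d0.
by rewrite H //; ring.
Qed.

(** [G - X] solves the homogeneous equation, so it equals [a M_d(n) + b M_d(n+1)] with [a] and [b]
    independent of [n]. They are computed from the values at 0 and 1 and inherit their degree
    bound. *)
Lemma mspan_defect k G X : mspan k X ->
  (forall d m n, (0 < d)%N -> defect G d m n = defect X d m n) ->
  polyspan k (fun d m _ => G d m 0%N) -> polyspan k (fun d m _ => G d m 1%N) ->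
  mspan k G.
Proof.
move=> [A [B [HA HB HX]]] HG HG0 HG1.
have rC := rational_on_posC.
have rdV : rational_on_pos (fun d => d%:R^-1).
  by apply: (rational_on_posV rational_on_pos_id) => d; rewrite pnatr_eq0 -lt0n.
have pN f : polyspan k f -> polyspan k (fun d m n => -1 * f d m n).
  by apply: (polyspanZ (rC (-1))).
pose X0 d m := A d m 0%N + B d m 0%N.
pose X1 d m := A d m 1%N + (1 + d%:R) * B d m 1%N.
have HX0 : polyspan k (fun d m _ => X0 d m).
  by apply: polyspanD; apply: polyspan_fix_n.
have HX1 : polyspan k (fun d m _ => X1 d m).
  apply: polyspanD; first exact: polyspan_fix_n.
  apply: (polyspanZ (c := fun d => 1 + d%:R)); last exact: polyspan_fix_n.
  by apply: rational_on_posD => //; exact: rational_on_pos_id.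
(* Let [u] and [v] be the values of [G - X] at 0 and 1. As [M_d(0) = M_d(1) = 1] and
   [M_d(2) = 1 + d], the conditions are [a + b = u] and [a + (1+d) b = v], whence [b = (v-u)/d] and
   [a = u - b]. *)
have Hu := polyspanD HG0 (pN _ HX0).
have Hv := polyspanD HG1 (pN _ HX1).
have Hb := polyspanZ rdV (polyspanD Hv (pN _ Hu)).
have Ha := polyspanD Hu (pN _ Hb).
have HA' := polyspanD HA Ha; have HB' := polyspanD HB Hb.
eexists; eexists; split; [exact: HA'|exact: HB'|] => d m n d0 /=.
have dn0 : d%:R != 0 :> rat by rewrite pnatr_eq0 -lt0n.
have M0 : (M d 0)%:R = 1 :> rat by [].
have M1 : (M d 1)%:R = 1 :> rat by rewrite /M /= muln0.
elim/ltn_ind: n => -[|[|n]] IH.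
- by rewrite M0 M1 /X0 /X1; field.
- by rewrite M_rec M0 M1 /X0 /X1; field.
have -> : G d m n.+2 = defect G d m n + G d m n.+1 + d%:R * G d m n.
  by rewrite /defect; ring.
rewrite (HG _ _ _ d0) /defect !(HX _ _ _ d0) (IH n.+1 (ltnSn _)) (IH n (leqnSn _)).
rewrite !M_rec; ring.
Qed.

(** Induction on [a + b], from the two initial values and the recurrence alone: every term of the
    double sum except [(0,0)] involves a moment with smaller [a + b]. *)
Lemma mspan_moment (G : nat -> nat -> nat -> nat -> nat -> rat) :
  (forall a b d m, G a b d m 0%N = (0 ^ a * 0 ^ b)%:R) ->
  (forall a b d m,
     G a b d m 1%N = (0 ^ a * 0 ^ b)%:R + colsum 1 a 'X^b d m 0%N) ->
  (forall a b d m n,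
     G a b d m n.+2 = G a b d m n.+1 + \sum_(i < a.+1) \sum_(j < b.+1)
       ('C(a, i) * 'C(b, j))%:R * (colsum 2 i 'X^j d m n * G (a - i)%N (b - j)%N d m n)) ->
  forall a b, mspan (2 * a + b) (G a b).
Proof.
move=> G0 G1 G_rec a b.
have [s le_ab] := ubnP (a + b)%N; elim: s => // s IH in a b le_ab *.
have pC k (x : rat) : polyspan k (fun _ _ _ => x).
  apply: polyspan_eq (polyspan_monomial (rational_on_posC x) (leq0n k : 0 + 0 <= k)%N).
  by move=> d m n _; rewrite bin0; ring.
have p0 : polyspan (2 * a + b) (fun d m _ => G a b d m 0%N).
  by apply: polyspan_eq (pC _ (0 ^ a * 0 ^ b)%:R) => d m _ _; rewrite G0.
have p1 : polyspan (2 * a + b) (fun d m _ => G a b d m 1%N).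
  have H := polyspan_fix_n 0 (polyspan_colsum 1 a 'X^b (pC 0 1)).
  have aab : (a + 0 <= 2 * a + b)%N by lia.
  apply: polyspan_eq (polyspanD (pC _ (0 ^ a * 0 ^ b)%:R) (polyspan_leq aab H)).
  by move=> d m _ _ /=; rewrite G1 mulr1.
pose T (i : 'I_a.+1) (j : 'I_b.+1) d m n := ('C(a, i) * 'C(b, j))%:R *
  (colsum 2 i 'X^j d m n * G (a - i)%N (b - j)%N d m n).
pose g d m n := \sum_(ij : 'I_a.+1 * 'I_b.+1 | ij != (ord0, ord0)) T ij.1 ij.2 d m n.
have defG d m n : defect (G a b) d m n = g d m n.
  (* The term [(0,0)] is [d G(n)], exactly what the operator subtracts. *)
  rewrite /defect G_rec pair_big /= (bigD1 (ord0, ord0)) //= !bin0 !subn0 mul1r.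
  rewrite -/(g d m n); have -> : colsum 2 0 'X^0 d m n = d%:R.
    rewrite /colsum; under eq_bigr do rewrite !expr0 hornerC mulr1.
    by rewrite sumr_const card_ord.
  by ring.
have Hg : mspan (2 * a + b).-1 g.
  apply: mspan_sum => -[[i /= Hi] [j /= Hj]]; rewrite -pair_eqE /= => ij0.
  have {}ij0 : (0 < i + j)%N by rewrite lt0n addn_eq0.
  apply: (mspanZ (rational_on_posC _)).
  have lt_s : (a - i + (b - j) < s)%N by lia.
  (* The degree is [i + 2(a-i) + (b-j) = 2a + b - (i+j)], below [2a + b] when that number is
     positive. *)
  by apply: mspan_leq (mspan_colsum 2 i 'X^j (IH _ _ lt_s)); lia.
(* For [a = b = 0] the predecessor of the degree is again 0, so the general argument would end at
   degree 1. There [g] is an empty sum, and zero is a particular solution. *)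
have [ab0|ab0] := posnP (2 * a + b).
  apply: (mspan_defect (mspan0 _)) p0 p1 => d m n d0; rewrite defG /defect.
  rewrite /g big1 ?mulr0 ?subr0 // => -[[i /= Hi] [j /= Hj]].
  by rewrite -pair_eqE /= -!val_eqE /=; lia.
have [X HX HXg] := solvable_mspan Hg; rewrite prednK // in HX.
by apply: (mspan_defect HX) p0 p1 => d m n d0; rewrite defG HXg.
Qed.

(** * Nice sets as sequences of column heights *)

Section Heights.
Local Open Scope nat_scope.

Variables d n : nat.
Implicit Types (I : {set array d n}) (f : {ffun 'I_n -> 'I_d.+1}).

Lemma card_ord_ltn c : c <= d -> #|[set i : 'I_d | i < c]| = c.
Proof.
move=> cd; rewrite -sum1_card big_mkcond; under eq_bigr do rewrite inE.
by rewrite -big_mkcond -(big_ord_widen _ (fun=> 1) cd) sum1_card card_ord.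
Qed.

(** If [i] is in [A], then [A] contains all of 0 to [i], so [#|A| > i]; if not, [A] lies strictly
    below [i], so [#|A| <= i]. *)
Lemma mem_initial_segment (A : {set 'I_d}) :
  (forall i i' : 'I_d, i' = i.+1 :> nat -> i' \in A -> i \in A) ->
  forall i, (i \in A) = (i < #|A|).
Proof.
move=> Adown i.
have {}Adown k (i1 i2 : 'I_d) : i2 = i1 + k :> nat -> i2 \in A -> i1 \in A.
  elim: k i2 => [|k IH] i2 e2 Ai2.
    by rewrite (_ : i1 = i2) //; apply: ord_inj; rewrite e2 addn0.
  have lt_d : i1 + k < d by have := ltn_ord i2; lia.
  by apply: (IH (Ordinal lt_d)) => //; apply: Adown Ai2; rewrite /= e2 addnS.
have [Ai|nAi] := boolP (i \in A).
  rewrite -{1}(card_ord_ltn (ltn_ord i)); symmetry.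
  apply: subset_leq_card; apply/subsetP => k; rewrite inE => ki.
  by apply: (Adown (i - k) k i) => //; lia.
symmetry; apply/negbTE; rewrite -leqNgt -(card_ord_ltn (ltnW (ltn_ord i))).
apply: subset_leq_card; apply/subsetP => k Ak; rewrite inE ltnNge.
by apply: contra nAi => ik; apply: (Adown (k - i) i k) => //; lia.
Qed.

Definition column I (j : 'I_n) : {set 'I_d} := [set i | (i, j) \in I].

(** A column has at most [d] elements, so [inord] never falls back on its default. *)
Definition heights I : {ffun 'I_n -> 'I_d.+1} := [ffun j => inord #|column I j|].

Definition subset_of_heights f : {set array d n} := [set p : array d n | p.1 < f p.2].

Definition sparse n (h : 'I_n -> nat) : bool :=
  [forall j : 'I_n, forall j' : 'I_n, (j' == j.+1 :> nat) ==> (h j == 0) || (h j' == 0)].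

Lemma heightsK f : heights (subset_of_heights f) = f.
Proof.
apply/ffunP => j; rewrite ffunE; apply: val_inj.
have fj : f j <= d by rewrite -ltnS.
have -> : column (subset_of_heights f) j = [set i : 'I_d | i < f j].
  by apply/setP => i; rewrite !inE.
by rewrite card_ord_ltn //= inordK.
Qed.

Lemma subset_of_heightsK I : nice I -> subset_of_heights (heights I) = I.
Proof.
case/andP => /forallP Idown _; apply/setP => -[i j]; rewrite inE ffunE /=.
rewrite inordK; last by rewrite ltnS -[X in _ <= X]card_ord max_card.
rewrite -mem_initial_segment ?inE // => {}i i' ei'; rewrite !inE.
by move: Idown => /(_ i)/forallP/(_ i')/forallP/(_ j); rewrite ei' eqxx /= => /implyP.
Qed.

Lemma nice_subset_of_heights f : nice (subset_of_heights f) = sparse (fun j => f j).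
Proof.
apply/andP/forallP => [[_ /forallP H] j|H]; [apply/forallP => j'|split].
- apply/implyP => ej'; apply/negPn; rewrite negb_or -!lt0n; apply/negP => /andP [fj fj'].
  (* A positive height forces [d > 0], so the first row, to which the second condition of [nice]
     refers, exists. *)
  have d0 : 0 < d by rewrite (leq_trans fj) // -ltnS.
  move: (H (Ordinal d0)) => /forallP/(_ j)/forallP/(_ j').
  by rewrite ej' !inE /= fj fj'.
- apply/forallP => i; apply/forallP => i'; apply/forallP => j.
  by apply/implyP => /eqP ei'; rewrite !inE /= ei'; apply/implyP; apply: ltnW.
apply/forallP => i; apply/forallP => j; apply/forallP => j'.
apply/implyP => /eqP i0; apply/implyP => ej'; rewrite !inE /= i0.
move: (H j) => /forallP/(_ j'); rewrite ej' /=.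
by case/orP => /eqP ->; rewrite ?implybT.
Qed.

Lemma sum_subset_of_heights f (w : nat -> nat -> nat) :
  \sum_(p in subset_of_heights f) w p.1 p.2 = \sum_j \sum_(i < f j) w i j.
Proof.
rewrite (eq_bigl (fun p : array d n => true && (p.1 < f p.2))) => [|p]; last first.
  by rewrite inE.
rewrite -(pair_big_dep xpredT (fun (i : 'I_d) j => i < f j) (fun i j => w i j)) /=.
rewrite (exchange_big_dep xpredT) //=; apply: eq_bigr => j _.
by rewrite -(big_ord_widen d (fun i => w i j)) // -ltnS.
Qed.

Lemma card_subset_of_heights f : #|subset_of_heights f| = \sum_j f j.
Proof.
rewrite -sum1_card (sum_subset_of_heights f (fun _ _ => 1)).
by apply: eq_bigr => j _; rewrite sum1_card card_ord.
Qed.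

(** This is the sum of [i m + j + 1] over [i < h]: the share of [sigma] due to the column of 0-based
    index [j] and height [h]. *)
Definition column_weight m j h := m * 'C(h, 2) + j.+1 * h.

Lemma sigma_subset_of_heights m f :
  sigma m (subset_of_heights f) = \sum_(j < n) column_weight m j (f j).
Proof.
rewrite /sigma (sum_subset_of_heights f (fun i j => i * m + j.+1)).
apply: eq_bigr => j _.
rewrite /column_weight big_split /= -big_distrl /= -bin2_sum big_mkord.
by rewrite sum_nat_const card_ord mulnC [j.+1 * _]mulnC.
Qed.

Lemma sum_nice m (F : nat -> nat -> nat) :
  \sum_(I : {set array d n} | nice I) F (sigma m I) #|I| =
  \sum_(f : {ffun 'I_n -> 'I_d.+1} | sparse (fun j => f j))
    F (\sum_(j < n) column_weight m j (f j)) (\sum_j f j).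
Proof.
rewrite (reindex_onto subset_of_heights heights) => [|I]; last exact: subset_of_heightsK.
apply: eq_big => [f|f _]; first by rewrite nice_subset_of_heights heightsK eqxx andbT.
by rewrite sigma_subset_of_heights card_subset_of_heights.
Qed.

End Heights.

(** * Recurrences obtained by removing the last column *)

Section LastColumn.
Local Open Scope nat_scope.

Lemma sum_ffun_recr (T : finType) n (Phi : {ffun 'I_n.+1 -> T} -> nat) :
  \sum_f Phi f = \sum_x \sum_(f : {ffun 'I_n -> T})
    Phi [ffun j => oapp f x (unlift ord_max j)].
Proof.
rewrite pair_big /=.
rewrite (reindex (fun p : T * {ffun 'I_n -> T} =>
   [ffun j => oapp p.2 p.1 (unlift ord_max j)])) //.
apply: onW_bij; exists (fun h : {ffun 'I_n.+1 -> T} =>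
   (h ord_max, [ffun j => h (lift ord_max j)])).
  move=> [x f] /=; rewrite ffunE unlift_none; congr pair.
  by apply/ffunP => j; rewrite !ffunE liftK.
move=> h; apply/ffunP => j; rewrite ffunE /=.
by case: unliftP => [k ->|->] //=; rewrite ffunE.
Qed.

Variable d : nat.

(** Vacuously true for [n = 0], so a first column may have any height. *)
Definition last_empty n (f : {ffun 'I_n -> 'I_d.+1}) : bool :=
  [forall j : 'I_n, (j.+1 == n) ==> (f j == 0 :> nat)].

Definition append_height n (f : {ffun 'I_n -> 'I_d.+1}) (x : 'I_d.+1) :
    {ffun 'I_n.+1 -> 'I_d.+1} := [ffun j => oapp f x (unlift ord_max j)].

Lemma append_height_lift n (f : {ffun 'I_n -> 'I_d.+1}) x j :
  append_height f x (lift ord_max j) = f j.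
Proof. by rewrite ffunE liftK. Qed.

Lemma append_height_max n (f : {ffun 'I_n -> 'I_d.+1}) x :
  append_height f x ord_max = x.
Proof. by rewrite ffunE unlift_none. Qed.

Lemma sum_append_height n (f : {ffun 'I_n -> 'I_d.+1}) x (w : nat -> nat -> nat) :
  \sum_(j < n.+1) w j (append_height f x j) = \sum_(j < n) w j (f j) + w n x.
Proof.
rewrite big_ord_recr /= append_height_max; congr (_ + _); apply: eq_bigr => j _.
by rewrite -[in RHS](append_height_lift f x) (_ : lift _ _ = widen_ord (leqnSn n) j) //;
  apply: ord_inj; rewrite /= /bump leqNgt ltn_ord.
Qed.

Lemma last_empty_append n (f : {ffun 'I_n -> 'I_d.+1}) x :
  last_empty (append_height f x) = (x == 0 :> nat).
Proof.
apply/forallP/idP => [/(_ ord_max)|x0 j]; first by rewrite eqxx append_height_max.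
apply/implyP; rewrite eqSS => /eqP jn.
by rewrite (_ : j = ord_max) ?append_height_max //; apply: val_inj.
Qed.

(** Appending a column creates a single new adjacent pair, formed by the old last column and the new
    one. *)
Lemma sparse_append n (f : {ffun 'I_n -> 'I_d.+1}) x :
  sparse (fun j => append_height f x j) =
  sparse (fun j => f j) && ((x == 0 :> nat) || last_empty f).
Proof.
have valL (j : 'I_n) : lift ord_max j = j :> nat by rewrite /= /bump leqNgt ltn_ord.
apply/forallP/andP => [H|[/forallP H Hx] j].
  split.
    apply/forallP => j; apply/forallP => j'.
    move: (H (lift ord_max j)) => /forallP/(_ (lift ord_max j')).
    by rewrite !append_height_lift !valL.
  rewrite -implyNb; apply/implyP => x0; apply/forallP => j; apply/implyP => jn.
  move: (H (lift ord_max j)) => /forallP/(_ ord_max).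
  rewrite append_height_lift append_height_max valL [_ == j.+1]eq_sym jn.
  by rewrite (negbTE x0) orbF.
apply/forallP => j'; apply/implyP; case: (unliftP ord_max j) => [k ->|->]; last first.
  by move/eqP => /= ej'; have := ltn_ord j'; rewrite ej' ltnn.
rewrite valL append_height_lift; case: (unliftP ord_max j') => [k' ->|->].
  by rewrite valL append_height_lift; move: (H k) => /forallP/(_ k')/implyP.
rewrite append_height_max /= => ek; case/orP: Hx => [->|/forallP/(_ k)].
  by rewrite orbT.
by rewrite eq_sym ek /= => ->.
Qed.

Variable m : nat.

(** [F] is arbitrary so that removing a column merely shifts its arguments; [P] is a family over all
    lengths so that the recursion can pass from [n.+1] to [n]. *)
Definition total (P : forall n, {ffun 'I_n -> 'I_d.+1} -> bool) n
    (F : nat -> nat -> nat) :=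
  \sum_(f : {ffun 'I_n -> 'I_d.+1} | sparse (fun j => f j) && P n f)
    F (\sum_(j < n) column_weight m j (f j)) (\sum_j f j).

Local Notation all_total := (total (fun _ _ => true)).
Local Notation last_empty_total := (total last_empty).

Lemma total_recr (P : forall n, {ffun 'I_n -> 'I_d.+1} -> bool) n F :
  total P n.+1 F = \sum_(x : 'I_d.+1)
    \sum_(f : {ffun 'I_n -> 'I_d.+1} | sparse (fun j => f j) &&
       (((x == 0 :> nat) || last_empty f) && P n.+1 (append_height f x)))
    F (\sum_(j < n) column_weight m j (f j) + column_weight m n x) (\sum_j f j + x).
Proof.
rewrite /total big_mkcond sum_ffun_recr; apply: eq_bigr => x _.
rewrite [RHS]big_mkcond; apply: eq_bigr => f _; rewrite -/(append_height f x).
rewrite sparse_append -andbA (sum_append_height f x (column_weight m)).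
by rewrite (sum_append_height f x (fun _ h => h)).
Qed.

Lemma last_empty_total_recr n F : last_empty_total n.+1 F = all_total n F.
Proof.
rewrite total_recr big_ord_recl [X in _ + X]big1 ?addn0 => [|h _].
  apply: eq_big => [f|f _]; first by rewrite last_empty_append.
  by rewrite /column_weight bin0n muln0 muln0 !addn0.
by rewrite big_pred0 // => f; rewrite last_empty_append !andbF.
Qed.

Lemma all_total_recr n F : all_total n.+1 F = all_total n F +
  \sum_(h < d) last_empty_total n
     (fun s c => F (s + column_weight m n h.+1) (c + h.+1)).
Proof.
rewrite total_recr big_ord_recl; congr (_ + _).
  by apply: eq_big => // f _; rewrite /column_weight bin0n muln0 muln0 !addn0.
by apply: eq_bigr => h _; apply: eq_bigl => f; rewrite andbT.
Qed.

Lemma total0 (P : forall n, {ffun 'I_n -> 'I_d.+1} -> bool) F :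
  (forall f, P 0 f) -> total P 0 F = F 0 0.
Proof.
move=> P0; rewrite /total (eq_bigl xpredT) => [|f]; last first.
  by rewrite P0 andbT; apply/forallP => -[].
under eq_bigr do rewrite !big_ord0.
by rewrite sum_nat_const card_ffun !card_ord expn0 mul1n.
Qed.

End LastColumn.

(** * The recurrence for the moments and the conclusion *)

Lemma Gplus_total d m a b n :
  Gplus d m a b n =
  total m (fun n (_ : {ffun 'I_n -> 'I_d.+1}) => true) n (fun s c => s ^ a * c ^ b)%N.
Proof.
rewrite /Gplus (sum_nice d n m (fun s c => s ^ a * c ^ b)%N).
by apply: eq_bigl => f; rewrite andbT.
Qed.

Lemma Gplus0 d m a b : Gplus d m a b 0 = (0 ^ a * 0 ^ b)%N.
Proof. by rewrite Gplus_total total0. Qed.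

Lemma Gplus1 d m a b : (Gplus d m a b 1)%:R =
  (0 ^ a * 0 ^ b)%:R + colsum 1 a 'X^b d m 0 :> rat.
Proof.
rewrite Gplus_total all_total_recr total0 // natrD; congr (_ + _); rewrite natr_sum.
apply: eq_bigr => h _; rewrite total0 => [|f]; last by apply/forallP => -[].
by rewrite hornerXn /column_weight !add0n natrM !natrX.
Qed.

Lemma Gplus_rec d m a b n : (Gplus d m a b n.+2)%:R =
  (Gplus d m a b n.+1)%:R + \sum_(i < a.+1) \sum_(j < b.+1)
    ('C(a, i) * 'C(b, j))%:R *
    (colsum 2 i 'X^j d m n * (Gplus d m (a - i) (b - j) n)%:R) :> rat.
Proof.
rewrite !Gplus_total all_total_recr natrD; congr (_ + _); rewrite natr_sum.
(* Below a last column of positive height, the empty column before it is dropped as well, which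
   leaves [n] columns. *)
under eq_bigr do rewrite last_empty_total_recr.
transitivity (\sum_(h < d) \sum_(i < a.+1) \sum_(j < b.+1)
   (('C(a, i) * 'C(b, j))%:R * ((m * 'C(h.+1, 2) + (n + 2) * h.+1)%:R ^+ i * h.+1%:R ^+ j)
     * (Gplus d m (a - i) (b - j) n)%:R) : rat).
  apply: eq_bigr => h _.
  under [RHS]eq_bigr => i _ do under eq_bigr => j _ do
    rewrite Gplus_total /total natr_sum mulr_sumr.
  under [RHS]eq_bigr => i _ do rewrite exchange_big.
  rewrite [RHS]exchange_big /total natr_sum; apply: eq_bigr => f _ /=.
  (* Both shifted powers are expanded by the binomial theorem; [i] and [j] are the exponents on the
     removed column's weight and height. *)
  rewrite natrM !natrX !natrD !exprDn big_distrlr /=.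
  apply: eq_bigr => i _; apply: eq_bigr => j _.
  rewrite [LHS]mulrnAl [X in X *+ _]mulrnAr -[LHS]mulrnA -[LHS]mulr_natl.
  (* The removed column has 0-based index [n.+1], hence the factor [n + 2]. *)
  rewrite /column_weight addn2.
  rewrite !(natrM, natrD, natrX).
  ring.
rewrite exchange_big /=; apply: eq_bigr => i _.
rewrite exchange_big /=; apply: eq_bigr => j _.
rewrite /colsum mulr_suml mulr_sumr; apply: eq_bigr => h _.
by rewrite hornerXn; ring.
Qed.

(* msize is the total degree plus one (and 0 for the zero polynomial). *)
Theorem theorem4p4 (a b : nat) :
  exists A B : {mpoly ratfun[2]},
    [/\ (msize A <= (2 * a + b).+1)%N,
        (msize B <= (2 * a + b).+1)%N &
        forall d m n : nat, (1 <= d)%N ->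
          [/\ regular_at A d, regular_at B d &
              (Gplus d m a b n)%:R =
                eval_at A m n d * (M d n)%:R + eval_at B m n d * (M d n.+1)%:R]].
Proof.
pose G a b d m n : rat := (Gplus d m a b n)%:R.
have G0 a' b' d m : G a' b' d m 0%N = (0 ^ a' * 0 ^ b')%:R by rewrite /G Gplus0.
have G1 a' b' d m : G a' b' d m 1%N = _ := Gplus1 d m a' b'.
have G2 a' b' d m n : G a' b' d m n.+2 = _ := Gplus_rec d m a' b' n.
have [A [B [HA HB H]]] := mspan_moment G0 G1 G2 a b.
have [P sP eP] := polyspan_mpoly HA; have [Q sQ eQ] := polyspan_mpoly HB.
exists P, Q; split=> // d m n d0; have [rP vP] := eP d d0; have [rQ vQ] := eQ d d0.
by split=> //; rewrite -vP -vQ; exact: H.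
Qed.
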